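(* Let $X$ be the bounded $\mathrm{CAT}(0)$ space constructed in the context (a two-dimensional simplicial complex inside the Euclidean cone over the tree $Y$). Then the weak topology $\mathcal T_{\Delta}$ and the coconvex topology $\mathcal T_{co}$ do not coincide on $X$.
   Context: All $\mathrm{CAT}(0)$ spaces are by definition complete and geodesic. A bounded sequence $(x_n)$ in a $\mathrm{CAT}(0)$ space $X$ converges weakly to a point $x\in X$ if for any compact geodesic $c$ in $X$ starting at $x$, the closest-point projections $\mathrm{Proj}_c(x_n)$ of $x_n$ to $c$ converge to $x$. The weak topology $\mathcal T_{\Delta}$ on $X$ is the topology whose closed sets are exactly those subsets $A\subset X$ such that whenever a bounded sequence of points of $A$ converges weakly to a point $x\in X$, one has $x\in A$. The coconvex topology $\mathcal T_{co}$ on $X$ is the coarsest topology on $X$ for which all metrically closed, convex subsets of $X$ are closed. Construction of $X$. Let $Y_1$ be a countably infinite family of intervals $[0,\frac{\pi}{4}]$ glued together at the common boundary point $0$ (with the length metric). Fix one endpoint $b$ among the countably many endpoints of the tree $Y_1$. Take a countably infinite family of isometric copies of $Y_1$ and glue all of them together by identifying the chosen endpoints $b$ with each other. The resulting space $Y$ (with its length metric) is a tree; let $p$ be the point at which all copies of $Y_1$ are glued together. The vertices of $Y$ are $p$, the branching points at distance $\frac{\pi}{4}$ from $p$, and the endpoints of $Y$ (at distance $\frac{\pi}{2}$ from $p$); all edges have length $\frac{\pi}{4}$. Let $\hat X$ be the Euclidean cone over $Y$ with tip $o$, and for $y\in Y$, $\lambda\ge 0$ let $\lambda\cdot y$ denote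 the point of $\hat X$ on the radial ray in direction $y$ at distance $\lambda$ from $o$; thus $d(\lambda\cdot y,\mu\cdot z)^2=\lambda^2+\mu^2-2\lambda\mu\cos(\min\{\pi, d_Y(y,z)\})$. For each edge $I$ of $Y$ with endpoints $y_1,y_2$ let $S_I$ be the (flat, filled) triangle in $\hat X$ with vertices $o$, $2\cdot y_1$, $2\cdot y_2$. Then $X$ is the union of all the triangles $S_I$; it is a closed convex bounded subset of $\hat X$, and is equipped with the induced metric. *)

(* Defs.v *)
From HB Require Import structures.
From mathcomp Require Import all_boot all_order all_algebra.
From mathcomp Require Import all_classical all_reals all_analysis.
From mathcomp Require Import ring lra.

Set Implicit Arguments.
Unset Strict Implicit.
Unset Printing Implicit Defensive.

Import Order.TTheory GRing.Theory Num.Theory.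
Import numFieldNormedType.Exports.

Local Open Scope classical_set_scope.
Local Open Scope ring_scope.

(* The library only gives [set_type A] the induced pseudometric. *)
Section induced_metric.
Context {R : realType} {T : metricType R} (A : set T).

Definition set_type_dist (x y : A) : R := mdist (set_val x) (set_val y).

Local Lemma set_type_dist_ge0 x y : 0 <= set_type_dist x y.
Proof. exact: mdist_ge0. Qed.

Local Lemma set_type_dist_pos x y : set_type_dist x y = 0 -> x = y.
Proof. by move=> /mdist_positivity; exact: val_inj. Qed.

Local Lemma ball_set_type_dist (x : A) (e : R) :
  ball x e = [set y | set_type_dist x y < e].
Proof.
rewrite /ball/=/initial_ball/=.
by apply/seteqP; split=> y /=; rewrite ballEmdist.
Qed.

HB.instance Definition _ := @PseudoMetric_isMetric.Build R (set_type A)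
  set_type_dist set_type_dist_ge0 set_type_dist_pos ball_set_type_dist.

Lemma mdist_set_val (x y : A) : mdist x y = mdist (set_val x) (set_val y).
Proof. by []. Qed.

End induced_metric.

Record pseudodist (R : realType) (T : Type) := Pseudodist {
  pdist :> T -> T -> R;
  pdist_xx : forall x, pdist x x = 0;
  pdist_sym : forall x y, pdist x y = pdist y x;
  pdist_triangle : forall y x z, pdist x z <= pdist x y + pdist y z }.

Section metric_quotient.
Context {R : realType} {T : choiceType} (d : pseudodist R T).
Local Open Scope quotient_scope.

Lemma pdist_ge0 x y : 0 <= d x y.
Proof.
have := pdist_triangle d y x x.
by rewrite pdist_xx (pdist_sym d y x) -mulr2n pmulrn_lge0.
Qed.

Definition indist : rel T := fun x y => d x y == 0.

Local Lemma indist_refl : reflexive indist.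
Proof. by move=> x; rewrite /indist pdist_xx. Qed.

Local Lemma indist_sym : symmetric indist.
Proof. by move=> x y; rewrite /indist pdist_sym. Qed.

Local Lemma indist_trans : transitive indist.
Proof.
move=> y x z /eqP xy /eqP yz; rewrite /indist eq_le pdist_ge0 andbT.
by rewrite (le_trans (pdist_triangle d y x z))// xy yz addr0.
Qed.

Canonical indist_equiv := EquivRel indist indist_refl indist_sym indist_trans.

Definition metric_quot : Type := {eq_quot indist_equiv}.

HB.instance Definition _ := Choice.on metric_quot.

Definition mclass (x : T) : metric_quot := \pi_({eq_quot indist_equiv}) x.

Definition mrepr (x : metric_quot) : T := repr (x : {eq_quot indist_equiv}).

Lemma mreprK : cancel mrepr mclass. Proof. by move=> x; exact: reprK. Qed.

Lemma mclass_eq x y : (mclass x = mclass y) <-> (d x y = 0).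
Proof.
by split=> [/eqmodP/eqP//|xy]; apply/eqmodP => /=; rewrite /indist xy.
Qed.

Definition quot_dist (x y : metric_quot) : R := d (mrepr x) (mrepr y).

Local Lemma quot_dist_mclass x y : quot_dist (mclass x) (mclass y) = d x y.
Proof.
have rx z : d (mrepr (mclass z)) z = 0 by apply/mclass_eq; rewrite mreprK.
have h a b a' b' : d a a' = 0 -> d b b' = 0 -> d a b <= d a' b'.
  move=> aa bb; rewrite (le_trans (pdist_triangle d a' a b))// aa add0r.
  by rewrite (le_trans (pdist_triangle d b' a' b))// (pdist_sym d b') bb addr0.
by apply/le_anti/andP; split; apply: h; rewrite // pdist_sym.
Qed.

Local Lemma quot_dist_xx x : quot_dist x x = 0. Proof. exact: pdist_xx. Qed.

Local Lemma quot_dist_pos x y : quot_dist x y = 0 -> x = y.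
Proof. by move=> /mclass_eq; rewrite !mreprK. Qed.

Local Lemma quot_dist_sym x y : quot_dist x y = quot_dist y x.
Proof. exact: pdist_sym. Qed.

Local Lemma quot_dist_triangle y x z :
  quot_dist x z <= quot_dist x y + quot_dist y z.
Proof. exact: pdist_triangle. Qed.

HB.instance Definition _ :=
  @isMetric.Build R metric_quot quot_dist
  quot_dist_xx quot_dist_pos quot_dist_sym quot_dist_triangle.

Lemma mdist_mclass x y : mdist (mclass x) (mclass y) = d x y.
Proof. exact: quot_dist_mclass. Qed.

End metric_quotient.

(* Countably many copies of [M] glued at [b]: a path between different copies
   passes through [b], which gives the length metric below. *)
Section wedge.
Context {R : realType} {M : metricType R} (b : M).

Definition wedge_dist (x y : nat * M) : R :=
  if x.1 == y.1 then mdist x.2 y.2 else mdist x.2 b + mdist b y.2.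

Local Lemma wedge_xx x : wedge_dist x x = 0.
Proof. by rewrite /wedge_dist eqxx mdistxx. Qed.

Local Lemma wedge_sym x y : wedge_dist x y = wedge_dist y x.
Proof.
rewrite /wedge_dist eq_sym; case: ifP => _; first exact: metric_sym.
by rewrite addrC; congr (_ + _); exact: metric_sym.
Qed.

Local Lemma wedge_triangle y x z :
  wedge_dist x z <= wedge_dist x y + wedge_dist y z.
Proof.
case: x y z => [i x] [j y] [k z]; rewrite /wedge_dist/=.
have xyb := metric_triangle x y b; have byz := metric_triangle b y z.
have xbz := metric_triangle x b z; have xyz := metric_triangle x y z.
have by0 := mdist_ge0 b y; have yb0 := mdist_ge0 y b.
case: (eqVneq i j) => [<-|ij]; first by case: ifP => _; lra.
case: (eqVneq j k) => [<-|jk]; first by rewrite (negbTE ij); lra.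
by case: ifP => _; lra.
Qed.

Definition wedge_pdist := Pseudodist wedge_xx wedge_sym wedge_triangle.

Definition wedge : Type := metric_quot wedge_pdist.

HB.instance Definition _ := Metric.on wedge.

Definition wedge_in (i : nat) (x : M) : wedge := mclass wedge_pdist (i, x).

Lemma mdist_wedge i x j y : mdist (wedge_in i x) (wedge_in j y) =
  if i == j then mdist x y else mdist x b + mdist b y.
Proof. exact: mdist_mclass. Qed.

End wedge.

Section cone.
Context {R : realType} {Y : metricType R}.
Implicit Types l m : {nonneg R}.

Definition cone_dist (u v : {nonneg R} * Y) : R :=
  let l := u.1%:num in let m := v.1%:num in
  Num.sqrt (l ^+ 2 + m ^+ 2 - l * m * cos (Num.min pi (mdist u.2 v.2)) *+ 2).

Local Lemma cone_xx u : cone_dist u u = 0.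
Proof.
rewrite /cone_dist mdistxx min_r ?pi_ge0// cos0 mulr1 -expr2 mulr2n subrr.
exact: sqrtr0.
Qed.

Local Lemma cone_sym u v : cone_dist u v = cone_dist v u.
Proof.
by rewrite /cone_dist metric_sym (addrC (u.1%:num ^+ 2)) (mulrC u.1%:num). Qed.

Local Lemma minkowski (x1 y1 x2 y2 : R) :
  Num.sqrt ((x1 + x2) ^+ 2 + (y1 + y2) ^+ 2) <=
  Num.sqrt (x1 ^+ 2 + y1 ^+ 2) + Num.sqrt (x2 ^+ 2 + y2 ^+ 2).
Proof.
set A := x1 ^+ 2 + y1 ^+ 2; set B := x2 ^+ 2 + y2 ^+ 2.
have A0 : 0 <= A by rewrite addr_ge0 ?sqr_ge0.
have B0 : 0 <= B by rewrite addr_ge0 ?sqr_ge0.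
rewrite -[leRHS]ger0_norm ?addr_ge0 ?sqrtr_ge0// -sqrtr_sqr ler_wsqrtr//.
rewrite [leRHS]sqrrD !sqr_sqrtr// -sqrtrM//.
suff : x1 * x2 + y1 * y2 <= Num.sqrt (A * B) by rewrite /A /B mulr2n; lra.
rewrite (le_trans (ler_norm _))// -sqrtr_sqr ler_wsqrtr//.
have := sqr_ge0 (x1 * y2 - x2 * y1); rewrite /A /B; lra.
Qed.

Local Lemma law_of_cosines (a b s t : R) :
  a ^+ 2 + b ^+ 2 - a * b * cos (s - t) *+ 2 =
  (a * cos s - b * cos t) ^+ 2 + (a * sin s - b * sin t) ^+ 2.
Proof.
rewrite cosB -[a ^+ 2]mulr1 -[b ^+ 2]mulr1 -{1}(cos2Dsin2 s) -(cos2Dsin2 t).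
ring.
Qed.

Local Lemma planar (a b c s t : R) :
  Num.sqrt (a ^+ 2 + c ^+ 2 - a * c * cos (s + t) *+ 2) <=
  Num.sqrt (a ^+ 2 + b ^+ 2 - a * b * cos s *+ 2) +
  Num.sqrt (b ^+ 2 + c ^+ 2 - b * c * cos t *+ 2).
Proof.
have := minkowski (a * cos s - b * cos 0) (a * sin s - b * sin 0)
  (b * cos 0 - c * cos (- t)) (b * sin 0 - c * sin (- t)).
rewrite -!law_of_cosines subr0 sub0r opprK; apply: le_trans.
by rewrite -{1}[t]opprK law_of_cosines ler_wsqrtr//; lra.
Qed.

Local Lemma cone_dist_mono (a b s t : R) : 0 <= a -> 0 <= b ->
  0 <= s -> s <= t -> t <= pi ->
  Num.sqrt (a ^+ 2 + b ^+ 2 - a * b * cos s *+ 2) <=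
  Num.sqrt (a ^+ 2 + b ^+ 2 - a * b * cos t *+ 2).
Proof.
move=> a0 b0 s0 st tpi; rewrite ler_wsqrtr// lerD2l lerN2 lerMn2r/=.
rewrite ler_wpM2l ?mulr_ge0//.
have s_in : s \in `[0, pi] by rewrite in_itv/= s0 (le_trans st).
have t_in : t \in `[0, pi] by rewrite in_itv/= tpi (le_trans s0).
by rewrite leNgt ltr_cos// -leNgt.
Qed.

Local Lemma cone_triangle v u w :
  cone_dist u w <= cone_dist u v + cone_dist v w.
Proof.
case: u v w => [l x] [m y] [n z]; rewrite /cone_dist/=.
have p0 := pi_ge0 R.
have xz := metric_triangle x y z.
have xy0 := mdist_ge0 x y; have yz0 := mdist_ge0 y z.
have xz0 := mdist_ge0 x z.
set al := Num.min pi (mdist x y); set be := Num.min pi (mdist y z).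
set ga := Num.min pi (mdist x z).
have al0 : 0 <= al by rewrite le_min p0.
have alpi : al <= pi by rewrite ge_min lexx.
have be0 : 0 <= be by rewrite le_min p0.
have bepi : be <= pi by rewrite ge_min lexx.
have ga0 : 0 <= ga by rewrite le_min p0.
have gapi : ga <= pi by rewrite ge_min lexx.
have gaD : ga <= al + be.
  rewrite /ga /al /be /Num.min /Order.min.
  by do 3!case: ltP => ?; lra.
pose be' := Num.min be (pi - al).
have be'0 : 0 <= be' by rewrite le_min be0 subr_ge0.
have be'be : be' <= be by rewrite ge_min lexx.
have D : al + be' <= pi by rewrite -lerBrDl ge_min lexx orbT.
apply: (@le_trans _ _ (Num.sqrt (l%:num ^+ 2 + n%:num ^+ 2 -
   l%:num * n%:num * cos (al + be') *+ 2))).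
  apply: cone_dist_mono => //.
  by rewrite -lerBlDl le_min lerBlDl gaD lerB.
apply: (le_trans (planar _ m%:num _ _ _)); rewrite lerD2l.
exact: cone_dist_mono.
Qed.

Definition cone_pdist := Pseudodist cone_xx cone_sym cone_triangle.

End cone.

Arguments cone_pdist {R} Y.

Section euclidean_cone.
Context {R : realType} (Y : metricType R).

Definition cone : Type := metric_quot (cone_pdist Y).

HB.instance Definition _ := Metric.on cone.

Definition cone_pt (l : {nonneg R}) (y : Y) : cone :=
  mclass (cone_pdist Y) (l, y).

Lemma mdist_cone_pt l y m z : mdist (cone_pt l y) (cone_pt m z) =
  Num.sqrt (l%:num ^+ 2 + m%:num ^+ 2 -
            l%:num * m%:num * cos (Num.min pi (mdist y z)) *+ 2).
Proof. exact: mdist_mclass. Qed.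

End euclidean_cone.

Section weak_convergence.
Context {R : realType} {T : metricType R}.

Definition geodesic (l : R) (c : R -> T) :=
  0 <= l /\ {in `[0, l] &, forall s t, mdist (c s) (c t) = `|s - t|}.

Definition is_proj (C : set T) (x q : T) :=
  C q /\ forall y, C y -> mdist x q <= mdist x y.

(* In a CAT(0) space the projection to a compact geodesic exists and is
   unique; the default value [x] is then irrelevant. *)
Definition Proj (C : set T) (x : T) : T := xget x [set q | is_proj C x q].

Definition weak_cvg (u : nat -> T) (x : T) :=
  forall (l : R) (c : R -> T), geodesic l c -> c 0 = x ->
    Proj (c @` `[0, l]) (u n) @[n --> \oo] --> x.

Definition bounded_seq (u : nat -> T) :=
  exists r : R, forall m n, mdist (u m) (u n) <= r.

Definition weakly_closed (A : set T) :=
  forall (u : nat -> T) (x : T), (forall n, A (u n)) ->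
    bounded_seq u -> weak_cvg u x -> A x.

Definition geodesically_convex (C : set T) :=
  forall (l : R) (c : R -> T), geodesic l c -> C (c 0) -> C (c l) ->
    c @` `[0, l] `<=` C.

End weak_convergence.

Section weak_topology.
Context {R : realType} (T : metricType R).

Definition weak_topology : Type := T.

HB.instance Definition _ := Choice.on weak_topology.

Definition weakly_open : set_system weak_topology :=
  [set A | weakly_closed (~` A : set T)].

Local Lemma weakly_openT : weakly_open setT.
Proof. by move=> u x uA; have := uA 0; rewrite setCT. Qed.

Local Lemma weakly_closed_bigcap (I : Type) (f : I -> set T) :
  (forall i, weakly_closed (f i)) -> weakly_closed (\bigcap_i f i).
Proof.
by move=> fw u x uf bu ux i _; apply: (fw i u x) => // n; exact: uf.
Qed.

Local Lemma weakly_openU (I : Type) (f : I -> set weak_topology) :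
  (forall i, weakly_open (f i)) -> weakly_open (\bigcup_i f i).
Proof.
by move=> fw; rewrite /weakly_open/= setC_bigcup; exact: weakly_closed_bigcap.
Qed.

Local Lemma weakly_closed_cofinal (A : set T) (u : nat -> T) (x : T) :
  weakly_closed A -> bounded_seq u -> weak_cvg u x ->
  (forall N, exists2 n, (N <= n)%N & A (u n)) -> A x.
Proof.
move=> Aw [r ur] ux uA.
have /choice[phi phiP] : forall N, exists n, (N <= n)%N /\ A (u n).
  by move=> N; have [n Nn An] := uA N; exists n.
apply: (Aw (u \o phi)) => [n||l c gc c0].
- by have [] := phiP n.
- by exists r => m n; exact: ur.
- apply: (cvg_comp _ _ _ (ux l c gc c0)).
  by move=> B [N _ NB]; exists N => // n/= Nn; apply: NB => /=;
    exact: leq_trans Nn (phiP n).1.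
Qed.

Local Lemma weakly_openI : setI_closed weakly_open.
Proof.
move=> A B Aw Bw; rewrite /weakly_open/= setCI => u x uAB bu ux.
have [uA|] := pselect (forall N, exists2 n, (N <= n)%N & (~` A) (u n)).
  by left; exact: weakly_closed_cofinal uA.
move=> /existsNP[N uA]; right.
apply: (@weakly_closed_cofinal _ u x) => // M; exists (maxn M N).
  exact: leq_maxl.
have [nA|//] := uAB (maxn M N); exfalso; apply: uA.
by exists (maxn M N) => //; exact: leq_maxr.
Qed.

HB.instance Definition _ := isOpenTopological.Build weak_topology
  weakly_openT weakly_openI weakly_openU.

Definition TDelta : set (set T) := @open weak_topology.

Lemma closed_weak_topology (A : set T) :
  @closed weak_topology A <-> weakly_closed A.
Proof.
rewrite -openC; split; first by rewrite /open/= /weakly_open/= setCK.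
by rewrite /open/= /weakly_open/= setCK.
Qed.

End weak_topology.

Arguments TDelta {R} T.

Section coconvex_topology.
Context {R : realType} (T : metricType R).

Definition coconvex_topology : Type := T.

HB.instance Definition _ := Choice.on coconvex_topology.

HB.instance Definition _ := isSubBaseTopological.Build coconvex_topology
  [set A : set T | closed (~` A) /\ geodesically_convex (~` A)] id.

Definition Tco : set (set T) := @open coconvex_topology.

Lemma closed_coconvex_topology (C : set T) :
  closed C -> geodesically_convex C -> @closed coconvex_topology C.
Proof.
move=> Cc Cg; rewrite -openC.
exists [set ~` C]; last by rewrite bigcup_set1.
by move=> _ ->; apply: finI_from1; rewrite /= setCK.
Qed.

Lemma coconvex_topology_coarsest (op : set_system T) :
  op setT -> setI_closed op ->
  (forall (I : Type) (f : I -> set T), (forall i, op (f i)) ->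
    op (\bigcup_i f i)) ->
  (forall C, closed C -> geodesically_convex C -> op (~` C)) ->
  Tco `<=` op.
Proof.
move=> opT opI opU opC _ [D Dsub <-].
have op0 : op set0.
  by rewrite -(bigcup0 (P := setT) (F := fun _ : void => set0)) //; exact: opU.
rewrite bigcup_mkcond; apply: opU => B; case: ifPn => [/set_mem DB|_].
  have [F Fsub <-] := Dsub _ DB.
  rewrite bigcap_fset big_seq; apply: big_ind => // A /Fsub.
  by rewrite inE/= => -[Ac Ag]; rewrite -[A]setCK; exact: opC.
exact: op0.
Qed.

End coconvex_topology.

Arguments Tco {R} T.

Section the_space.
Context (R : realType).

Definition seg : set R^o := `[0, pi / 4].

Local Lemma pi4_ge0 : 0 <= pi / 4 :> R. Proof. by rewrite divr_ge0 ?pi_ge0. Qed.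

Local Lemma seg_left : (0 : R^o) \in seg.
Proof. by rewrite mem_setE in_itv/= lexx pi4_ge0. Qed.

Local Lemma seg_right : (pi / 4 : R^o) \in seg.
Proof. by rewrite mem_setE in_itv/= lexx pi4_ge0. Qed.

Definition seg0 : seg := exist _ 0 seg_left.
Definition seg1 : seg := exist _ (pi / 4) seg_right.

Definition Y1 : metricType R := wedge seg0.

Definition Y1_end : Y1 := wedge_in seg0 0 seg1.

Definition Y : metricType R := wedge Y1_end.

(* The [k]-th edge of the [i]-th copy of [Y1]; [t = 0] is its branching point,
   and [t = pi / 4] is [p] if [k = 0], an endpoint of [Y] otherwise. *)
Definition edge (i k : nat) (t : seg) : Y :=
  wedge_in Y1_end i (wedge_in seg0 k t).

(* As an edge has length [pi / 4 < pi], [l . edge i k t] is the point with polar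
   coordinates [(l, t)] in a flat sector, in which the vertices of the triangle
   are [0], [2 (cos 0, sin 0)] and [2 (cos (pi / 4), sin (pi / 4))]. *)
Definition triangle (i k : nat) : set (cone Y) :=
  [set x | exists (l : {nonneg R}) (t : seg) (a b : R),
    [/\ x = cone_pt l (edge i k t), 0 <= a, 0 <= b & a + b <= 1] /\
    l%:num * cos (set_val t) = a * 2 + b * (2 * cos (pi / 4)) /\
    l%:num * sin (set_val t) = b * (2 * sin (pi / 4))].

Definition X : metricType R := set_type (\bigcup_i \bigcup_k triangle i k).

End the_space.

(* Main.v *)
(* Write [h = cos (pi / 4)], [o] for the tip, [b_i] for the branching points of
   [Y] and [e_ik] (with [k != 0]) for its endpoints.  Let [A] consist of [o],
   [1 . p], all [2h . b_i] and all [2 . e_ik].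

   [A] is weakly closed: the points [2 . e_ik] converge weakly to [2h . b_i] as
   [k] grows and to [o] as [i] grows, and [2h . b_i] converges weakly to
   [1 . p].  The only geodesics needed to see this are segments inside one flat
   triangle.  If [mu . v] lies beyond the end [g] of the sector of [x], its
   nearest point on that sector is [mu cos d(v, g) . g], or [o] if the cosine is
   negative.  It is nearer than [x] by a margin depending, apart from [x], only
   on [mu] and [d(v, g)]; so along a sequence of such points the projections to
   the segment from [x] to it cannot tend to [x].

   [A] is not coconvexly closed: if finitely many convex sets cover [A], one of
   them contains, for two values of [i], two points [2 . e_ik] each.  The chord
   of each pair passes through [2h . b_i], the chord of the resulting two points
   through [1 . p], and a chord between points with different [i] through [o].
   Hence this set contains [1/2 . p], which is not in [A]. *)

Require Import Defs.
From mathcomp Require Import finmap.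
From mathcomp Require Import all_boot all_order all_algebra.
From mathcomp Require Import all_classical all_reals all_analysis.
From mathcomp Require Import ring lra.

Set Implicit Arguments.
Unset Strict Implicit.
Unset Printing Implicit Defensive.

Import Order.TTheory GRing.Theory Num.Theory.
Import numFieldNormedType.Exports.

Local Open Scope classical_set_scope.
Local Open Scope ring_scope.

(** * Trigonometry at [pi / 4], and polar coordinates *)

Section trigonometry.
Context {R : realType}.
Local Notation h := (cos (pi / 4) : R).

Lemma pi4_gt0 : 0 < pi / 4 :> R.
Proof. by rewrite divr_gt0 ?pi_gt0. Qed.

Lemma cos_pi4_gt0 : 0 < h.
Proof. by apply: cos_gt0_pihalf; have := pi_gt0 R; lra. Qed.

Lemma sin_pi4 : sin (pi / 4) = h.
Proof.
have := tan_piquarter R; rewrite /tan => e.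
by rewrite -[LHS](divfK (lt0r_neq0 cos_pi4_gt0)) e mul1r.
Qed.

Lemma sqr_cos_pi4 : h * h = 1 / 2.
Proof. by have := cos2Dsin2 (pi / 4 : R); rewrite sin_pi4 !expr2; lra. Qed.

Lemma cos_pi4_bounds : 1 / 2 < h < 1.
Proof. by have := cos_pi4_gt0; have := sqr_cos_pi4; nra. Qed.

Lemma cos_3pi4_le0 : cos (pi / 4 + pi / 2) <= 0 :> R.
Proof. by rewrite cosDpihalf sin_pi4; have := cos_pi4_gt0; lra. Qed.

(** The condition on [u] and [v] describes the quarter plane about the positive axis, which is the
    flat cone over two adjacent edges; the angle is [atan (v / u)], bounded by [atan 1]. *)
Lemma polar_coords (u v : R) : `|v| <= u -> exists r s,
  [/\ 0 <= r, - (pi / 4) <= s <= pi / 4, u = r * cos s & v = r * sin s].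
Proof.
move=> vu; have u0 : 0 <= u by exact: le_trans vu.
have [u_eq0|u_neq0] := eqVneq u 0.
  exists 0, 0; have := pi4_gt0; rewrite !mul0r u_eq0; split=> //; first lra.
  by apply/eqP; rewrite -normr_le0 -u_eq0.
have u_gt0 : 0 < u by rewrite lt_neqAle eq_sym u_neq0.
pose s := atan (v / u).
have cs : 0 < cos s.
  by apply: cos_gt0_pihalf; rewrite /s atan_gtNpi2 atan_ltpi2.
exists (u / cos s), s; split.
- by rewrite divr_ge0// ltW.
- rewrite -atan1 -atanN !le_atan//.
    by rewrite ler_pdivrMr// mul1r (le_trans (ler_norm _)).
  by rewrite ler_pdivlMr// mulN1r lerNl (le_trans (ler_norm _))// normrN.
- by rewrite divfK// gt_eqF.
- have := atanK (v / u); rewrite -/s /tan => e.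
  by rewrite mulrAC -mulrA e mulrCA divff// mulr1.
Qed.

End trigonometry.

(** * Points of [X] in polar coordinates, and distances in the tree *)

Section space.
Context {R : realType}.
Implicit Types (i j k l : nat) (r s t : R).
Local Notation h := (cos (pi / 4) : R).

Definition cpt r (y : Y R) : cone (Y R) := cone_pt (`|r|%:nng) y.

(** [insubd] sends a parameter outside [[0, pi / 4]] to 0, whence the [on_edge] hypotheses below. *)
Definition edge_pt i k s : Y R := edge i k (insubd (seg0 R) (s : R^o)).

Definition on_edge s := 0 <= s <= pi / 4.

Lemma val_insubd_seg s :
  on_edge s -> set_val (insubd (seg0 R) (s : R^o)) = s.
Proof. by move=> s0; apply: insubdK; rewrite mem_setE in_itv. Qed.

Lemma edgeE i k (t : @seg R) : on_edge (set_val t : R) /\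
  edge i k t = edge_pt i k (set_val t).
Proof.
have ton : on_edge (set_val t) by have := set_valP t; rewrite /seg/= in_itv.
split=> //; rewrite /edge_pt; congr edge.
by apply: val_inj; exact/esym/(val_insubd_seg ton).
Qed.

Lemma mdist_seg (s t : @seg R) : mdist s t = `|set_val s - set_val t|.
Proof. by rewrite distrC. Qed.

(** Distance to the hub [p]: edge 0 leads from the branching point to [p], any other edge leads away
    from it. *)
Definition dist_p k s := if k == 0 then pi / 4 - s else pi / 4 + s.

Lemma mdist_edge_pt i k s j l t : on_edge s -> on_edge t ->
  mdist (edge_pt i k s) (edge_pt j l t) =
  if i == j then if k == l then `|s - t| else s + t
  else dist_p k s + dist_p l t.
Proof.
move=> sE tE; have p0 := @pi4_gt0 R.
have v0 : set_val (seg0 R) = 0 by [].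
have v1 : set_val (seg1 R) = pi / 4 by [].
rewrite /edge_pt /edge mdist_wedge /Y1_end !mdist_wedge !mdist_seg.
rewrite !val_insubd_seg// v0 v1 /dist_p (eq_sym 0%N l).
move: sE tE; rewrite /on_edge => /andP[s0 s1] /andP[t0 t1].
rewrite !subr0 !sub0r !normrN (ger0_norm s0) (ger0_norm t0).
rewrite (ger0_norm (ltW p0)).
rewrite [ `|s - pi / 4|]ler0_norm ?subr_le0// opprB.
rewrite [ `|pi / 4 - t|]ger0_norm ?subr_ge0// (addrC s (pi / 4)).
by [].
Qed.

Lemma mdist_cpt r y t z : 0 <= r -> 0 <= t -> mdist (cpt r y) (cpt t z) =
  Num.sqrt (r ^+ 2 + t ^+ 2 - r * t * cos (Num.min pi (mdist y z)) *+ 2).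
Proof. by move=> r0 t0; rewrite /cpt mdist_cone_pt/= !ger0_norm. Qed.

Lemma cpt0 y z : cpt 0 y = cpt 0 z.
Proof.
by apply: mdist_positivity; rewrite mdist_cpt// !mul0r mul0rn expr0n/= !addr0
  subr0 sqrtr0.
Qed.

(** Since the cosine is at most 1, the squared distance is at least [(r - t) ^ 2]. *)
Lemma cpt_radius r y t z : 0 <= r -> 0 <= t -> cpt r y = cpt t z -> r = t.
Proof.
move=> r0 t0 e; have := mdistxx (cpt r y); rewrite {2}e mdist_cpt//.
move=> /eqP; rewrite sqrtr_eq0 => le0.
have c1 : cos (Num.min pi (mdist y z)) <= 1 by exact: cos_le1.
have : (r - t) ^+ 2 <= 0.
  have := ler_wpM2l (mulr_ge0 r0 t0) c1; move: le0; rewrite mulr2n; lra.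
rewrite le_eqVlt ltNge sqr_ge0 orbF sqrf_eq0 subr_eq0.
by move=> /eqP.
Qed.

(** The last condition is [a + b <= 1] for the coefficients in [triangle]: with [u = r cos s],
    [v = r sin s] and [2 h h = 1] they are [a = (u - v) / 2] and [b = h v]. Their signs come from
    the other two conditions. *)
Definition in_tri r s :=
  [/\ 0 <= r, on_edge s &
      (r * cos s - r * sin s) / 2 + h * (r * sin s) <= 1].

Lemma on_edge_cos_sin s :
  on_edge s -> [/\ 0 <= sin s, sin s <= cos s & 0 <= cos s].
Proof.
move=> /andP[s0 s1]; have p0 := pi_gt0 R.
have c0 : 0 <= cos s by apply: cos_ge0_pihalf; lra.
split=> //; first by apply: sin_ge0_pi; lra.
have : 0 <= sin (pi / 4 - s) by apply: sin_ge0_pi; lra.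
by rewrite sinB sin_pi4 -mulrBr pmulr_rge0 ?cos_pi4_gt0// subr_ge0.
Qed.

Lemma triangleP i k z :
  triangle i k z <-> exists r s, in_tri r s /\ z = cpt r (edge_pt i k s).
Proof.
have h0 := @cos_pi4_gt0 R; have hh := @sqr_cos_pi4 R.
split=> [[l [t [a [b [[-> a0 b0 ab1] [ec es]]]]]]|[r [s [[r0 sE le1] ->]]]].
  have [tE te] := edgeE i k t.
  exists l%:num, (set_val t); rewrite te; split; last first.
    by rewrite /cpt; congr cone_pt; apply: val_inj; rewrite /= ger0_norm.
  split=> //; rewrite ec es sin_pi4; nra.
have [ss sc cc] := on_edge_cos_sin sE.
exists (`|r|%:nng), (insubd (seg0 R) s), ((r * cos s - r * sin s) / 2),
  (h * (r * sin s)).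
have rs0 : 0 <= r * sin s by exact: mulr_ge0.
have rsc : r * sin s <= r * cos s by exact: ler_wpM2l.
rewrite /= val_insubd_seg// sin_pi4; split; first split=> //.
- lra.
- exact: mulr_ge0 (ltW h0) rs0.
- rewrite ger0_norm//.
  have -> : h * (r * sin s) * (2 * h) = r * sin s.
    rewrite [LHS](_ : _ = 2 * (h * h) * (r * sin s)); last by ring.
    by rewrite hh; lra.
  by split; lra.
Qed.

Definition xval (x : X R) : cone (Y R) := set_val (x : set_type _).

Lemma xvalP x : exists i k r s, in_tri r s /\ xval x = cpt r (edge_pt i k s).
Proof.
have [i _ [k _ /triangleP[r [s]]]] := set_valP (x : set_type _).
by exists i, k, r, s.
Qed.

Lemma xval_ex i k r s : in_tri r s -> exists x, xval x = cpt r (edge_pt i k s).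
Proof.
move=> rs; pose XX : set (cone (Y R)) := \bigcup_i \bigcup_k triangle i k.
have xX : cpt r (edge_pt i k s) \in XX.
  by rewrite inE; exists i => //; exists k => //; apply/triangleP; exists r, s.
by exists (exist (fun z => z \in XX) _ xX).
Qed.

Lemma xval_inj : injective xval.
Proof. by move=> x y; exact: val_inj. Qed.

Lemma mdist_xval x y : mdist x y = mdist (xval x) (xval y).
Proof. by []. Qed.

End space.

(** * Distances along weakly convergent sequences *)

Section weak_convergence.
Context {R : realType} {T : metricType R}.

(* Whether or not the projection to the geodesic exists, [Proj] is at least as
   close to [u n] as [c s]. *)
Lemma weak_cvg_dist (u : nat -> T) x l (c : R -> T) s e :
  weak_cvg u x -> geodesic l c -> c 0 = x -> 0 <= s <= l -> 0 < e ->
  \forall n \near \oo, mdist (u n) x < mdist (u n) (c s) + e.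
Proof.
move=> ux cl c0 sl e0; have := ux l c cl c0.
move=> /cvg_ballP/(_ e e0); apply: filterS => n; rewrite ballEmdist/= => xe.
set q := Proj _ _ in xe.
have qs : mdist (u n) q <= mdist (u n) (c s).
  rewrite /q /Proj; case: xgetP => [y _ [_ yP]|_].
    by apply: yP; exists s => //=; rewrite in_itv.
  (* Without a projection, [q] is the default [u n], at distance 0. *)
  by rewrite mdistxx mdist_ge0.
have := metric_triangle (u n) q x; rewrite (metric_sym q); lra.
Qed.

End weak_convergence.

(** * Flat coordinates on the cone over a path of two edges *)

Section flat_sectors.
Context {R : realType}.
Implicit Types (g : R -> Y R) (z : X R).

Definition isometric_path g := forall s t,
  - (pi / 4) <= s <= pi / 4 -> - (pi / 4) <= t <= pi / 4 ->
  mdist (g s) (g t) = `|s - t|.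

Definition coords g z u v := exists r s,
  [/\ 0 <= r, - (pi / 4) <= s <= pi / 4, xval z = cpt r (g s),
      u = r * cos s & v = r * sin s].

(** Angles along [g] differ by at most [pi / 2], so the law of cosines turns the cone distance into
    the Euclidean one. *)
Lemma mdist_coords g z z' u v u' v' : isometric_path g ->
  coords g z u v -> coords g z' u' v' ->
  mdist z z' = Num.sqrt ((u - u') ^+ 2 + (v - v') ^+ 2).
Proof.
move=> gi [r [s [r0 sE ze -> ->]]] [r' [s' [r'0 s'E z'e -> ->]]].
have p0 := pi_gt0 R.
rewrite mdist_xval ze z'e mdist_cpt// gi// min_r; last first.
  by rewrite ler_norml; lra.
have -> : cos `|s - s'| = cos (s - s').
  by case: (ger0P (s - s')) => // _; rewrite cosN.
congr Num.sqrt; rewrite cosB -[r ^+ 2]mulr1 -[r' ^+ 2]mulr1.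
rewrite -{1}(cos2Dsin2 s) -(cos2Dsin2 s'); ring.
Qed.

Lemma coords_inj g z z' u v : isometric_path g ->
  coords g z u v -> coords g z' u v -> z = z'.
Proof.
move=> gi zu z'u; apply: mdist_positivity; rewrite (mdist_coords gi zu z'u).
by rewrite !subrr expr0n addr0 sqrtr0.
Qed.

(** The straight segment, at unit speed. That it stays in [X] is a hypothesis, as [X] is only part
    of the cone; the last clause finds a point on the path from its coordinates alone. *)
Lemma flat_geodesic g z0 z1 u0 v0 u1 v1 : isometric_path g ->
  coords g z0 u0 v0 -> coords g z1 u1 v1 ->
  (forall t, 0 <= t <= 1 -> exists z,
    coords g z (u0 + t * (u1 - u0)) (v0 + t * (v1 - v0))) ->
  exists l c, [/\ geodesic l c, c 0 = z0, c l = z1 &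
    forall t z, 0 <= t <= 1 ->
      coords g z (u0 + t * (u1 - u0)) (v0 + t * (v1 - v0)) ->
      exists2 s, 0 <= s <= l & c s = z].
Proof.
move=> gi z0u z1u zt; set q := (u1 - u0) ^+ 2 + (v1 - v0) ^+ 2.
pose l := Num.sqrt q; have l0 : 0 <= l by exact: sqrtr_ge0.
have q0 : 0 <= q by rewrite addr_ge0 ?sqr_ge0.
have ll : l * l = q by rewrite -expr2 sqr_sqrtr.
have [l_eq0|l_neq0] := eqVneq l 0.
  have [uu vv] : u1 = u0 /\ v1 = v0.
    have := sqr_ge0 (u1 - u0); have := sqr_ge0 (v1 - v0).
    move: ll; rewrite l_eq0 mul0r /q => qq a b.
    have /eqP : (u1 - u0) ^+ 2 = 0 by lra.
    have /eqP : (v1 - v0) ^+ 2 = 0 by lra.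
    by rewrite !sqrf_eq0 !subr_eq0 => /eqP-> /eqP->.
  subst u1 v1; exists 0, (fun=> z0); split.
  - split=> // s t; rewrite !in_itv/= mdistxx => s0 t0.
    by have -> : s - t = 0 by [lra]; rewrite normr0.
  - by [].
  - exact: coords_inj z0u z1u.
  - move=> t z t01; rewrite !subrr !mulr0 !addr0 => zu; exists 0 => //.
      by rewrite lexx.
    exact: coords_inj z0u zu.
have l_gt0 : 0 < l by rewrite lt_neqAle eq_sym l_neq0.
(* [P] is void outside [[0, l]], so that [c] can be chosen as a total function. *)
pose P s z := 0 <= s <= l ->
  coords g z (u0 + s / l * (u1 - u0)) (v0 + s / l * (v1 - v0)).
have /choice[c cP] : forall s, exists z, P s z.
  move=> s; have [sl|/negP sl] := boolP (0 <= s <= l); last by exists z0.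
  have /andP[s0 s1] := sl.
  have [|z zu] := zt (s / l); last by exists z.
  by rewrite divr_ge0//= ler_pdivrMr// mul1r.
exists l, c; split.
- split=> // s t; rewrite !in_itv/= => sl tl.
  rewrite (mdist_coords gi (cP _ sl) (cP _ tl)).
  rewrite [X in Num.sqrt X](_ : _ = (s - t) ^+ 2) ?sqrtr_sqr//.
  rewrite [LHS](_ : _ = (s - t) ^+ 2 / (l * l) * q); last by rewrite /q; field.
  by rewrite -ll divfK// mulf_neq0.
- apply: (coords_inj gi (cP 0 _)); first by rewrite lexx.
  by rewrite mul0r !mul0r !addr0.
- apply: (coords_inj gi (cP l _)); first by rewrite lexx l0.
  by rewrite divff// !mul1r !subrKC.
- move=> t z /andP[t0 t1] zu.
  have tl : 0 <= t * l <= l by rewrite mulr_ge0//= ler_piMl.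
  exists (t * l) => //; apply: (coords_inj gi (cP _ tl)).
  by rewrite mulfK.
Qed.

Lemma convex_flat g (C : set (X R)) z0 z1 u0 v0 u1 v1 t z :
  isometric_path g -> geodesically_convex C ->
  coords g z0 u0 v0 -> coords g z1 u1 v1 ->
  (forall t, 0 <= t <= 1 -> exists z,
    coords g z (u0 + t * (u1 - u0)) (v0 + t * (v1 - v0))) ->
  C z0 -> C z1 -> 0 <= t <= 1 ->
  coords g z (u0 + t * (u1 - u0)) (v0 + t * (v1 - v0)) -> C z.
Proof.
move=> gi CC z0u z1u zt Cz0 Cz1 t01 zu.
have [l [c [cl c0 c1 cz]]] := flat_geodesic gi z0u z1u zt.
have [s sl <-] := cz t z t01 zu.
by apply: (CC l c cl); rewrite ?c0 ?c1.
Qed.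

End flat_sectors.

(** * Paths through a vertex of the tree, and gates between sectors *)

Section gates.
Context {R : realType}.
Implicit Types (i j k : nat) (r s t : R) (x : X R).
Local Notation h := (cos (pi / 4) : R).

(** Runs from edge [l] to edge [k], with the branching point at parameter 0. *)
Definition cross_path i k (l : nat) s :=
  if 0 <= s then edge_pt i k s else edge_pt i l (- s).

Lemma cross_path_isometric i k l : k != l -> isometric_path (cross_path i k l).
Proof.
move=> kl s t sE tE; rewrite /cross_path.
case: (leP 0 s) => s0; case: (leP 0 t) => t0;
  rewrite mdist_edge_pt /on_edge ?eqxx ?(negbTE kl) 1?eq_sym ?(negbTE kl) //;
  try lra.
- by rewrite ger0_norm; lra.
- by rewrite ler0_norm; lra.
- by rewrite distrC opprK addrC.
Qed.

(** Here [p] is at parameter 0; as edge 0 ends at [p], its own parameter is [pi / 4] minus the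
    distance to [p]. *)
Definition hub_path i j s :=
  if 0 <= s then edge_pt i 0 (pi / 4 - s) else edge_pt j 0 (pi / 4 + s).

Lemma hub_path_isometric i j : i != j -> isometric_path (hub_path i j).
Proof.
move=> ij s t sE tE; rewrite /hub_path.
case: (leP 0 s) => s0; case: (leP 0 t) => t0;
  rewrite mdist_edge_pt /on_edge ?eqxx ?(negbTE ij) 1?eq_sym ?(negbTE ij) //;
  rewrite /dist_p /=; try lra.
- by rewrite distrC; congr `| _ |; lra.
- by rewrite ger0_norm; lra.
- by rewrite ler0_norm; lra.
- by congr `| _ |; lra.
Qed.

Lemma flat_triangle_pt i k (u v : R) :
  0 <= v <= u -> (u - v) / 2 + h * v <= 1 -> exists x r s,
  [/\ in_tri r s, xval x = cpt r (edge_pt i k s), u = r * cos s &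
      v = r * sin s].
Proof.
move=> /andP[v0 vu] le1; have p0 := @pi4_gt0 R.
have [|r [s [r0 sE ue ve]]] := @polar_coords R u v; first by rewrite ger0_norm.
have [s0|s0] := leP 0 s.
  have rs : in_tri r s by split; rewrite -?ue -?ve// /on_edge s0; lra.
  by have [x xe] := xval_ex i k rs; exists x, r, s.
(* A negative angle with [0 <= v] is possible only at the tip, where the angle may be replaced by
   0. *)
have r_eq0 : r = 0.
  have sN : 0 < sin (- s) by apply: sin_gt0_pi; lra.
  apply/eqP; rewrite eq_le r0 andbT leNgt; apply/negP => r1.
  by have := mulr_gt0 r1 sN; rewrite sinN; lra.
have rs : in_tri (0 : R) 0.
  by split; rewrite /on_edge ?lexx ?mul0r//; lra.
have [x xe] := xval_ex i k rs; exists x, 0, 0.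
by rewrite ue ve r_eq0 !mul0r.
Qed.

Lemma triangle_geodesic i k r s r' s' x x' :
  in_tri r s -> xval x = cpt r (edge_pt i k s) ->
  in_tri r' s' -> xval x' = cpt r' (edge_pt i k s') ->
  exists l c, [/\ geodesic l c, c 0 = x & c l = x'].
Proof.
move=> [r0 sE le1] xe [r'0 s'E le1'] x'e; have p0 := @pi4_gt0 R.
(* Any edge other than [k] can continue the path; the segment stays over edge [k], since the
   inequalities of the triangle are linear in the flat coordinates. *)
have co : forall r s y,
    0 <= r -> on_edge s -> xval y = cpt r (edge_pt i k s) ->
    coords (cross_path i k k.+1) y (r * cos s) (r * sin s).
  clear -p0 => r s y r0 sE ye; exists r, s; move: sE => /andP[s0 s1].
  by split=> //; [lra|rewrite /cross_path s0].
have gi : isometric_path (cross_path i k k.+1).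
  by apply: cross_path_isometric; rewrite neq_ltn ltnSn.
have [|l [c [cl c0 c1 _]]] :=
  flat_geodesic gi (co _ _ _ r0 sE xe) (co _ _ _ r'0 s'E x'e).
  move=> t t01; have [||y [q [w [qw ye -> ->]]]] := @flat_triangle_pt i k
    (r * cos s + t * (r' * cos s' - r * cos s))
    (r * sin s + t * (r' * sin s' - r * sin s)).
  - have [S SC _] := on_edge_cos_sin sE; have [S' SC' _] := on_edge_cos_sin s'E.
    have := mulr_ge0 r0 S; have := ler_wpM2l r0 SC.
    have := mulr_ge0 r'0 S'; have := ler_wpM2l r'0 SC'.
    nra.
  - by nra.
  - by exists y; case: qw => *; exact: co.
by exists l, c.
Qed.

(* The cone over the gate [edge_pt i k s'] separates the points [mu . v] below
   from the sector of [x], so that the nearest point to [mu . v] on that side is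
   [rho . edge_pt i k s'], strictly nearer than [x] by a margin independent of
   [v]. *)
Lemma gate_near (u : nat -> X R) x i k lam s rho s' mu th :
  weak_cvg u x -> xval x = cpt lam (edge_pt i k s) -> in_tri lam s ->
  in_tri rho s' -> xval x <> cpt rho (edge_pt i k s') ->
  0 <= mu -> 0 <= th <= pi ->
  rho = mu * cos th \/ rho = 0 /\ cos th <= 0 ->
  \forall n \near \oo, ~ exists v,
    [/\ xval (u n) = cpt mu v, mdist v (edge_pt i k s') = th &
        mdist v (edge_pt i k s) = th + `|s' - s|].
Proof.
move=> ux xe lams rhos' xne mu0 /andP[th0 thpi] rhoE.
have [y ye] := xval_ex i k rhos'.
have [l [c [cl c0 c1]]] := triangle_geodesic lams xe rhos' ye.
have [lam0 sE _] := lams; have [rho0 s'E _] := rhos'.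
set b := Num.min pi (th + `|s' - s|).
have thb : th <= b by rewrite le_min thpi lerDl normr_ge0.
have bpi : b <= pi by rewrite ge_min lexx.
have th_in : th \in `[0, pi] by rewrite in_itv/= th0.
have b_in : b \in `[0, pi] by rewrite in_itv/= bpi (le_trans th0).
have cb : cos b <= cos th by rewrite leNgt ltr_cos// -leNgt.
(* Squared distances from [mu . v] to the gate point and to [x]; [b] is the angle at the tip towards
   [x], capped at [pi]. *)
pose D1 := mu ^+ 2 + rho ^+ 2 - mu * rho * cos th *+ 2.
pose D0 := mu ^+ 2 + lam ^+ 2 - mu * lam * cos b *+ 2.
have D10 : D1 < D0.
  have ml : 0 <= mu * lam * (cos th - cos b) by rewrite !mulr_ge0// subr_ge0.
  (* Unequal radii: if [rho = mu cos th], then [D0 - D1 = (lam - rho) ^ 2 + 2 mu lam (cos th - cos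
     b)]. *)
  have [lamrho|lamrho] := eqVneq lam rho; last first.
    have : 0 < (lam - rho) ^+ 2 by rewrite exprn_even_gt0//= subr_eq0.
    rewrite /D1 /D0; case: rhoE => [rhoE|[rhoE cth]].
      have -> : cos th = cos b + (cos th - cos b) by lra.
      have rr : rho * lam = mu * lam * cos th by rewrite rhoE mulrAC.
      have rr2 : rho * rho = mu * rho * cos th by rewrite {1}rhoE mulrAC.
      rewrite !mulr2n; nra.
    rewrite rhoE subr0 !mulr0 !mul0r mul0rn subr0 => lam2.
    have : 0 <= mu * lam * - cos th by rewrite !mulr_ge0// oppr_ge0.
    rewrite !mulr2n; nra.
  (* Equal radii: the gain comes from the angle. As [x] is not the gate point, [lam > 0] and
     [s' <> s]; with [cos th > 0] this gives [th < b]. *)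
  have lam_gt0 : 0 < lam.
    rewrite lt_neqAle lam0 andbT; apply/eqP => lam_eq0; apply: xne.
    by rewrite xe -lamrho -lam_eq0; exact: cpt0.
  have rhomu : rho = mu * cos th.
    by case: rhoE => // -[re _]; move: lam_gt0; rewrite lamrho re ltxx.
  have mu_gt0 : 0 < mu.
    rewrite lt_neqAle mu0 andbT; apply/eqP => mu_eq0.
    by move: lam_gt0; rewrite lamrho rhomu -mu_eq0 mul0r ltxx.
  have cth : 0 < cos th by rewrite -(pmulr_rgt0 _ mu_gt0) -rhomu -lamrho.
  have ss : s' != s by apply/eqP => ss; apply: xne; rewrite xe lamrho ss.
  have thlt : th < b.
    rewrite lt_min ltrDl normr_gt0 subr_eq0 ss andbT.
    rewrite lt_neqAle thpi andbT; apply/eqP => the.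
    by move: cth; rewrite the cospi; lra.
  have cblt : cos b < cos th by rewrite ltr_cos.
  rewrite /D1 /D0 -lamrho ltrD2l ltrN2 ltrMn2r//=.
  by rewrite ltr_pM2l// mulr_gt0.
have D1_ge0 : 0 <= D1.
  have : cos th <= 1 by exact: cos_le1.
  move=> /(ler_wpM2l (mulr_ge0 mu0 rho0)); have := sqr_ge0 (mu - rho).
  by rewrite /D1 mulr2n; lra.
have sD : Num.sqrt D1 < Num.sqrt D0 by rewrite ltr_sqrt// (le_lt_trans _ D10).
have e0 : 0 < Num.sqrt D0 - Num.sqrt D1 by rewrite subr_gt0.
have l_in : 0 <= l <= l by rewrite lexx andbT; case: cl.
have := weak_cvg_dist ux cl c0 l_in e0; apply: filterS => n + [v [ve vs' vs]].
rewrite c1 !mdist_xval ve xe ye !mdist_cpt// vs' vs (min_r thpi) -/b -/D0 -/D1.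
by rewrite subrKC ltxx.
Qed.

End gates.

(** * Weak closedness of the discrete set *)

Section discrete_set.
Context {R : realType}.
Implicit Types (i j k : nat) (r s t : R) (x : X R).
Local Notation h := (cos (pi / 4) : R).

(** The set [A], with one fixed name for each point that lies over several edges. *)
Definition special : set (cone (Y R)) :=
  [set cpt 0 (edge_pt 0 0 0)] `|` [set cpt 1 (edge_pt 0 0 (pi / 4))] `|`
  range (fun i => cpt (2 * h) (edge_pt i 0 0)) `|`
  [set z | exists i k, k != 0 /\ z = cpt 2 (edge_pt i k (pi / 4))].

Lemma on_edge0 : on_edge (0 : R).
Proof. by rewrite /on_edge lexx/= ltW// pi4_gt0. Qed.

Lemma on_edge_pi4 : on_edge (pi / 4 : R).
Proof. by rewrite /on_edge lexx andbT ltW// pi4_gt0. Qed.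

Lemma edge_pt_branch i k k' : edge_pt i k 0 = edge_pt i k' 0 :> Y R.
Proof.
apply: mdist_positivity; rewrite mdist_edge_pt ?on_edge0// eqxx subrr normr0.
by rewrite addr0 if_same.
Qed.

Lemma edge_pt_hub i j : edge_pt i 0 (pi / 4) = edge_pt j 0 (pi / 4) :> Y R.
Proof.
apply: mdist_positivity; rewrite mdist_edge_pt ?on_edge_pi4// eqxx /dist_p /=.
by rewrite !subrr normr0 addr0 if_same.
Qed.

Lemma in_tri_branch r : 0 <= r <= 2 -> in_tri r 0.
Proof.
by move=> /andP[r0 r2]; split; rewrite ?on_edge0// cos0 sin0 !mulr0; lra.
Qed.

Lemma in_tri_pi4 r : 0 <= r <= 2 -> in_tri r (pi / 4).
Proof.
move=> /andP[r0 r2]; split; rewrite ?on_edge_pi4// sin_pi4.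
by have := @sqr_cos_pi4 R; nra.
Qed.

(** Seen from the edge of [x], the special points fall into finitely many classes, each with one
    radius and one distance to its gate. [gate_near] eventually rules out a class unless [x] is its
    nearest point, and that point is special in every case but one: from an edge [k <> 0], the point
    nearest to [1 . p] is [h . b_i]. *)
Lemma weak_limit_dichotomy (u : nat -> X R) x i k lam s :
  (forall n, special (xval (u n))) -> weak_cvg u x ->
  xval x = cpt lam (edge_pt i k s) -> in_tri lam s ->
  special (xval x) \/ k <> 0%N /\ xval x = cpt h (edge_pt i k 0).
Proof.
move=> us ux xe xT.
have [?|xns] := pselect (special (xval x)); first by left.
right; have [_ sE _] := xT; have := sE; rewrite /on_edge => /andP[s0 s1].
have p0 := pi_gt0 R.
have h0 := @cos_pi4_gt0 R; have hh := @sqr_cos_pi4 R.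
have /andP[hl hu] := @cos_pi4_bounds R.
have z0 := on_edge0; have z1 := on_edge_pi4.
have abs0 : `|0 - s| = s by rewrite sub0r normrN ger0_norm.
have abs1 : `|pi / 4 - s| = pi / 4 - s by rewrite ger0_norm ?subr_ge0.
have xo y : xval x <> cpt 0 y.
  move=> xy; apply: xns; left; left; left; rewrite xy; exact: cpt0.
have xm : xval x <> cpt (2 * h) (edge_pt i k 0).
  move=> xy; apply: xns; left; right; exists i => //.
  by rewrite xy (edge_pt_branch i k 0).
pose Ev mu s' th n := exists v,
    [/\ xval (u n) = cpt mu v, mdist v (edge_pt i k s') = th &
        mdist v (edge_pt i k s) = th + `|s' - s|].
have ev_o : \forall n \near \oo, ~ Ev 0 0 0 n.
  apply: (gate_near (rho := 0) ux xe xT (in_tri_branch _)) => //;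
  rewrite ?lexx; try lra; (by left; rewrite mul0r).
have ev_mi : \forall n \near \oo, ~ Ev (2 * h) 0 0 n.
  apply: (gate_near (rho := 2 * h) ux xe xT (in_tri_branch _)) => //;
  rewrite ?lexx; try lra; (by left; rewrite cos0 mulr1).
have ev_ei : \forall n \near \oo, ~ Ev 2 0 (pi / 4) n.
  apply: (gate_near (rho := 2 * h) ux xe xT (in_tri_branch _)) => //;
  rewrite ?lexx; try lra; (by left).
(* On edge 0 the gates are the branching point, towards copy [i], and [p], towards the other
   copies. *)
have [k0|k0] := eqVneq k 0%N.
  subst k; exfalso.
  have xp : xval x <> cpt 1 (edge_pt i 0 (pi / 4)).
    by move=> xy; apply: xns; left; left; right; rewrite xy (edge_pt_hub i 0).
  have ev_p : \forall n \near \oo, ~ Ev 1 (pi / 4) 0 n.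
    apply: (gate_near (rho := 1) ux xe xT (in_tri_pi4 _)) => //;
    rewrite ?lexx; try lra; (by left; rewrite cos0 mulr1).
  have ev_mj : \forall n \near \oo, ~ Ev (2 * h) (pi / 4) (pi / 4) n.
    apply: (gate_near (rho := 1) ux xe xT (in_tri_pi4 _)) => //;
    rewrite ?lexx; try lra; (by left; lra).
  have ev_ej : \forall n \near \oo, ~ Ev 2 (pi / 4) (pi / 2) n.
    apply: (gate_near (rho := 0) ux xe xT (in_tri_pi4 _)) => //;
    rewrite ?lexx; try lra; (by left; rewrite cos_pihalf mulr0).
  (* One [n] outside all classes contradicts that [u n] is special. *)
  have [n [[[no nmi] nei] [[np nmj] nej]]] :=
    filter_ex (filterI (filterI (filterI ev_o ev_mi) ev_ei)
            (filterI (filterI ev_p ev_mj) ev_ej)).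
  have [[[un|un]|[j _ un]]|[j [l [l0 un]]]] := us n.
  - apply: no; exists (edge_pt i 0 0); split; first by rewrite un; exact: cpt0.
      exact: mdistxx.
    by rewrite mdist_edge_pt// !eqxx [RHS]add0r.
  - apply: np; exists (edge_pt i 0 (pi / 4)); rewrite (edge_pt_hub i 0).
    split=> //; first exact: mdistxx.
    by rewrite -(edge_pt_hub i 0) mdist_edge_pt// !eqxx add0r.
  - have [ji|ji] := eqVneq j i.
      subst j; apply: nmi; exists (edge_pt i 0 0); split=> //.
        exact: mdistxx.
      by rewrite mdist_edge_pt// !eqxx [RHS]add0r.
    apply: nmj; exists (edge_pt j 0 0); split=> //.
      by rewrite mdist_edge_pt// (negbTE ji) /dist_p/=; lra.
    by rewrite mdist_edge_pt// (negbTE ji) abs1 /dist_p/=; lra.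
  - have [ji|ji] := eqVneq j i.
      subst j; apply: nei; exists (edge_pt i l (pi / 4)); split=> //.
        by rewrite mdist_edge_pt// eqxx (negbTE l0) addr0.
      by rewrite mdist_edge_pt// eqxx (negbTE l0) abs0.
    apply: nej; exists (edge_pt j l (pi / 4)); split=> //.
      by rewrite mdist_edge_pt// (negbTE ji) /dist_p (negbTE l0)/=; lra.
    by rewrite mdist_edge_pt// (negbTE ji) abs1 /dist_p (negbTE l0)/=; lra.
split; first exact/eqP.
have [//|xb] := pselect (xval x = cpt h (edge_pt i k 0)); exfalso.
have xe1 : xval x <> cpt 2 (edge_pt i k (pi / 4)).
  by move=> xy; apply: xns; right; exists i, k.
have ev_p : \forall n \near \oo, ~ Ev 1 0 (pi / 4) n.
  apply: (gate_near (rho := h) ux xe xT (in_tri_branch _)) => //;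
  rewrite ?lexx; try lra; (by left; rewrite mul1r).
have ev_mj : \forall n \near \oo, ~ Ev (2 * h) 0 (pi / 2) n.
  apply: (gate_near (rho := 0) ux xe xT (in_tri_branch _)) => //;
  rewrite ?lexx; try lra; (by left; rewrite cos_pihalf mulr0).
have ev_ek : \forall n \near \oo, ~ Ev 2 (pi / 4) 0 n.
  apply: (gate_near (rho := 2) ux xe xT (in_tri_pi4 _)) => //;
  rewrite ?lexx; try lra; (by left; rewrite cos0 mulr1).
(* At this obtuse angle the tip is the nearest point. *)
have ev_ej : \forall n \near \oo, ~ Ev 2 0 (pi / 4 + pi / 2) n.
  apply: (gate_near (rho := 0) ux xe xT (in_tri_branch _)) => //;
  rewrite ?lexx; try lra; (by right; split=> //; exact: cos_3pi4_le0).
have [n [[[no nmi] nei] [[np nmj] [nek nej]]]] :=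
  filter_ex (filterI (filterI (filterI ev_o ev_mi) ev_ei)
          (filterI (filterI ev_p ev_mj) (filterI ev_ek ev_ej))).
have [[[un|un]|[j _ un]]|[j [l [l0 un]]]] := us n.
- apply: no; exists (edge_pt i k 0); split; first by rewrite un; exact: cpt0.
    exact: mdistxx.
  by rewrite mdist_edge_pt// !eqxx [RHS]add0r.
- apply: np; exists (edge_pt i 0 (pi / 4)); rewrite {1}(edge_pt_hub i 0).
  split=> //.
    by rewrite mdist_edge_pt// eqxx eq_sym (negbTE k0) addr0.
  by rewrite mdist_edge_pt// eqxx eq_sym (negbTE k0) abs0.
- have [ji|ji] := eqVneq j i.
    subst j; apply: nmi; exists (edge_pt i k 0).
    rewrite {1}(edge_pt_branch i k 0).
    split=> //; first exact: mdistxx.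
    by rewrite mdist_edge_pt// !eqxx [RHS]add0r.
  apply: nmj; exists (edge_pt j 0 0); split=> //.
    by rewrite mdist_edge_pt// (negbTE ji) /dist_p (negbTE k0)/=; lra.
  by rewrite mdist_edge_pt// (negbTE ji) abs0 /dist_p (negbTE k0)/=; lra.
- have [ji|ji] := eqVneq j i.
    subst j; have [lk|lk] := eqVneq l k.
      subst l; apply: nek; exists (edge_pt i k (pi / 4)); split=> //.
        exact: mdistxx.
      by rewrite mdist_edge_pt// !eqxx [RHS]add0r.
    apply: nei; exists (edge_pt i l (pi / 4)); split=> //.
      by rewrite mdist_edge_pt// eqxx (negbTE lk) addr0.
    by rewrite mdist_edge_pt// eqxx (negbTE lk) abs0.
  apply: nej; exists (edge_pt j l (pi / 4)); split=> //.
    by rewrite mdist_edge_pt// (negbTE ji) /dist_p (negbTE l0) (negbTE k0)/=;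
      lra.
  by rewrite mdist_edge_pt// (negbTE ji) abs0 /dist_p (negbTE l0) (negbTE k0)/=;
    lra.
Qed.

(** The exceptional point [h . b_i] also lies over edge 0 of its copy, where the dichotomy has no
    exception. *)
Lemma special_weakly_closed : weakly_closed (xval @^-1` special).
Proof.
move=> u x us _ ux; have [i [k [lam [s [xT xe]]]]] := xvalP x.
have [//|[k0 xb]] := weak_limit_dichotomy us ux xe xT.
have /andP[hl hu] := @cos_pi4_bounds R.
have hT : in_tri h 0 by apply: in_tri_branch; lra.
rewrite (edge_pt_branch i k 0) in xb.
by have [//|[]] := weak_limit_dichotomy us ux xb hT.
Qed.

End discrete_set.

(** * Convex sets containing special points, and finite convex covers *)

Section convex_closure.
Context {R : realType}.
Implicit Types (i j k : nat) (r s t : R) (x y : X R).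
Local Notation h := (cos (pi / 4) : R).

(** In the flat cone over the edges [k] and [k'] the endpoints are [(2 h, 2 h)] and [(2 h, - 2 h)],
    with midpoint [(2 h, 0)]. *)
Lemma convex_branch (C : set (X R)) i k k' x x' y :
  geodesically_convex C -> k != k' ->
  xval x = cpt 2 (edge_pt i k (pi / 4)) -> C x ->
  xval x' = cpt 2 (edge_pt i k' (pi / 4)) -> C x' ->
  xval y = cpt (2 * h) (edge_pt i 0 0) -> C y.
Proof.
move=> CC kk' xe Cx x'e Cx' ye; have p0 := @pi4_gt0 R.
have h0 := @cos_pi4_gt0 R; have hh := @sqr_cos_pi4 R.
have /andP[hl hu] := @cos_pi4_bounds R.
have xu : coords (cross_path i k k') x (2 * h) (2 * h).
  exists 2, (pi / 4); split=> //; first lra.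
    by rewrite /cross_path ltW.
  by rewrite sin_pi4.
have x'u : coords (cross_path i k k') x' (2 * h) (- (2 * h)).
  exists 2, (- (pi / 4)); split=> //; first lra.
  - by rewrite /cross_path leNgt oppr_lt0 p0/= opprK.
  - by rewrite cosN.
  - by rewrite sinN sin_pi4; lra.
apply: (convex_flat (t := 1 / 2) (cross_path_isometric i kk') CC xu x'u) => //.
(* The half with [0 <= v] lies in the triangle over [k], the other one in that over [k']. *)
- move=> t t01; have [v0|v0] := leP 0 (2 * h + t * (- (2 * h) - 2 * h)).
    have [||z [r [s [[r0 sE le1] ze -> ->]]]] := @flat_triangle_pt R i k
      (2 * h + t * (2 * h - 2 * h)) (2 * h + t * (- (2 * h) - 2 * h)).
    + by nra.
    + by nra.
    + exists z, r, s; move: sE => /andP[s0 s1]; split=> //; first lra.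
      by rewrite /cross_path s0.
  have [||z [r [s [[r0 sE le1] ze -> ve]]]] := @flat_triangle_pt R i k'
    (2 * h + t * (2 * h - 2 * h)) (- (2 * h + t * (- (2 * h) - 2 * h))).
  + by nra.
  + by nra.
  + exists z, r, (- s); move: sE => /andP[s0 s1]; split=> //; first lra.
    * rewrite ze /cross_path oppr_ge0 opprK; case: ifP => // s0'.
      have -> : s = 0 by lra.
      by rewrite oppr0 (edge_pt_branch i k k').
    * by rewrite cosN.
    * by rewrite sinN mulrN -ve opprK.
- by lra.
- exists (2 * h), 0; split.
  + by lra.
  + by lra.
  + by rewrite ye /cross_path ifT ?lexx// (edge_pt_branch i k 0).
  + by rewrite cos0; lra.
  + by rewrite sin0; lra.
Qed.

(** As [2 h h = 1], the two points are [(1, 1)] and [(1, -1)] in the cone over the path through [p];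
    their midpoint is [(1, 0)]. *)
Lemma convex_hub (C : set (X R)) i j x x' y :
  geodesically_convex C -> i != j ->
  xval x = cpt (2 * h) (edge_pt i 0 0) -> C x ->
  xval x' = cpt (2 * h) (edge_pt j 0 0) -> C x' ->
  xval y = cpt 1 (edge_pt 0 0 (pi / 4)) -> C y.
Proof.
move=> CC ij xe Cx x'e Cx' ye; have p0 := @pi4_gt0 R.
have h0 := @cos_pi4_gt0 R; have hh := @sqr_cos_pi4 R.
have /andP[hl hu] := @cos_pi4_bounds R.
have xu : coords (hub_path i j) x 1 1.
  exists (2 * h), (pi / 4); rewrite sin_pi4; split; [lra|lra| |lra|lra].
  by rewrite /hub_path ltW// subrr.
have x'u : coords (hub_path i j) x' 1 (-1).
  exists (2 * h), (- (pi / 4)); rewrite cosN sinN sin_pi4.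
  split; [lra|lra| |lra|lra].
  by rewrite /hub_path leNgt oppr_lt0 p0/= subrr.
apply: (convex_flat (t := 1 / 2) (hub_path_isometric ij) CC xu x'u) => //.
- move=> t t01; have [|r [s [r0 sE ue ve]]] :=
    @polar_coords R (1 + t * (1 - 1)) (1 + t * (- 1 - 1)).
    by rewrite ler_norml; nra.
  have r2 : r <= 2 * h.
    have : r * r = (r * cos s) ^+ 2 + (r * sin s) ^+ 2.
      by rewrite !exprMn -mulrDr cos2Dsin2 mulr1 expr2.
    by rewrite -ue -ve; nra.
  (* With sine and cosine bounded by 1, the left side of the last condition is at most
     [r h <= 2 h h = 1]. *)
  have tri a : on_edge a -> in_tri r a.
    move=> aE; have [a0 ac ca] := on_edge_cos_sin aE; split=> //.
    have := cos_le1 a; have := sin_le1 a => s1 c1.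
    have := ler_wpM2l r0 s1; have := ler_wpM2l r0 c1; have := mulr_ge0 r0 a0.
    nra.
  rewrite ue ve; have [s0|s0] := leP 0 s.
    have [|z ze] := @xval_ex R i 0 r (pi / 4 - s).
      by apply: tri; rewrite /on_edge; lra.
    by exists z, r, s; split=> //; rewrite /hub_path s0.
  have [|z ze] := @xval_ex R j 0 r (pi / 4 + s).
    by apply: tri; rewrite /on_edge; lra.
  by exists z, r, s; split=> //; rewrite /hub_path leNgt s0.
- by lra.
- exists 1, 0; rewrite cos0 sin0; split; [lra|lra| |lra|lra].
  by rewrite ye /hub_path ifT ?lexx// subr0 (edge_pt_hub i 0).
Qed.

(** The two endpoints are at distance [pi] in the tree, so a geodesic runs along two radii through
    the tip. This angle exceeds [pi / 2], whence the direct construction. *)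
Lemma convex_tip (C : set (X R)) i j k k' x x' y :
  geodesically_convex C -> i != j -> k != 0%N -> k' != 0%N ->
  xval x = cpt 2 (edge_pt i k (pi / 4)) -> C x ->
  xval x' = cpt 2 (edge_pt j k' (pi / 4)) -> C x' ->
  xval y = cpt 0 (edge_pt 0 0 0) -> C y.
Proof.
move=> CC ij k0 k'0 xe Cx x'e Cx' ye; have p0 := pi_gt0 R.
(* Unit speed from [x] to [x'], reaching the tip at [s = 2]. *)
pose c0 s := if s <= 2 then cpt (2 - s) (edge_pt i k (pi / 4))
             else cpt (s - 2) (edge_pt j k' (pi / 4)).
have same r t z : 0 <= r -> 0 <= t -> mdist (cpt r z) (cpt t z) = `|r - t|.
  move=> r0 t0; rewrite mdist_cpt// mdistxx min_r ?(ltW p0)// cos0 mulr1.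
  by rewrite -sqrtr_sqr; congr Num.sqrt; rewrite mulr2n; ring.
have opp r t : 0 <= r -> 0 <= t ->
    mdist (cpt r (edge_pt i k (pi / 4))) (cpt t (edge_pt j k' (pi / 4))) =
    r + t.
  move=> r0 t0; rewrite mdist_cpt// mdist_edge_pt ?on_edge_pi4// (negbTE ij).
  rewrite /dist_p (negbTE k0) (negbTE k'0) [X in Num.min _ X](_ : _ = pi).
    rewrite min_l// cospi -[RHS]ger0_norm ?addr_ge0// -sqrtr_sqr.
    by congr Num.sqrt; rewrite mulr2n; ring.
  by lra.
have /choice[c cP] : forall s, exists z, 0 <= s <= 4 -> xval z = c0 s.
  move=> s; have [s04|/negP s04] := boolP (0 <= s <= 4); last by exists y.
  rewrite /c0; case: leP => s2.
    have [|z ze] := @xval_ex R i k (2 - s) (pi / 4); last by exists z.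
    by apply: in_tri_pi4; lra.
  have [|z ze] := @xval_ex R j k' (s - 2) (pi / 4); last by exists z.
  by apply: in_tri_pi4; lra.
have cg : geodesic 4 c.
  split=> // s t; rewrite !in_itv/= => sE tE.
  rewrite mdist_xval !cP// /c0; case: leP => s2; case: leP => t2.
  - by rewrite same; [rewrite distrC; congr `| _ |; lra|lra|lra].
  - by rewrite opp; [rewrite ler0_norm; lra|lra|lra].
  - by rewrite metric_sym opp; [rewrite ger0_norm; lra|lra|lra].
  - by rewrite same; [congr `| _ |; lra|lra|lra].
have c_eq s z : 0 <= s <= 4 -> xval z = c0 s -> c s = z.
  by move=> sE zs; apply: xval_inj; rewrite cP.
rewrite -(c_eq 2 y); last 2 first.
- by lra.
- by rewrite ye /c0 ifT ?lexx// subrr; exact: cpt0.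
apply: (CC 4 c cg).
- rewrite (c_eq 0 x)//; first by lra.
  by rewrite xe /c0 subr0 ifT//; lra.
- rewrite (c_eq 4 x')//; first by lra.
  by rewrite x'e /c0 ifF; [congr cpt; lra|apply/negbTE; rewrite -ltNge; lra].
- by exists 2 => //=; rewrite in_itv/=; lra.
Qed.

(** The radius towards [p] is the axis [v = 0] of the flat cone over a path through [p]. *)
Lemma convex_ray (C : set (X R)) x x' y :
  geodesically_convex C ->
  xval x = cpt 0 (edge_pt 0 0 0) -> C x ->
  xval x' = cpt 1 (edge_pt 0 0 (pi / 4)) -> C x' ->
  xval y = cpt (1 / 2) (edge_pt 0 0 (pi / 4)) -> C y.
Proof.
move=> CC xe Cx x'e Cx' ye; have p0 := @pi4_gt0 R.
have hub0 : hub_path 0 1 0 = edge_pt 0 0 (pi / 4) :> Y R.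
  by rewrite /hub_path ifT ?lexx// subr0.
have co z r : 0 <= r -> xval z = cpt r (edge_pt 0 0 (pi / 4)) ->
    coords (hub_path 0 1) z r 0.
  move=> r0 ze; exists r, 0; rewrite hub0 cos0 sin0 mulr1 mulr0.
  by split=> //; lra.
have xe' : xval x = cpt 0 (edge_pt 0 0 (pi / 4)) by rewrite xe; exact: cpt0.
have gi : isometric_path (@hub_path R 0 1) by exact: hub_path_isometric.
apply: (convex_flat (t := 1 / 2) gi CC (co _ _ _ xe') (co _ _ _ x'e)) => //.
- move=> t t01; rewrite subrr mulr0 addr0 subr0 add0r mulr1.
  have [|z ze] := @xval_ex R 0 0 t (pi / 4); first by apply: in_tri_pi4; lra.
  by exists z; apply: co => //; lra.
- by lra.
- by rewrite subrr mulr0 addr0 subr0 add0r mulr1; apply: co => //; lra.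
Qed.

(** The radii of special points are 0, 1, [2 h > 1] and 2. *)
Lemma half_not_special y :
  xval y = cpt (1 / 2) (edge_pt 0 0 (pi / 4)) -> ~ special (xval y).
Proof.
have h0 := @cos_pi4_gt0 R; have /andP[hl hu] := @cos_pi4_bounds R.
move=> -> [[[|]|[i _]]|[i [k [_]]]].
- by move=> /cpt_radius H; have := H ltac:(lra) ltac:(lra); lra.
- by move=> /cpt_radius H; have := H ltac:(lra) ltac:(lra); lra.
- by move=> /cpt_radius H; have := H ltac:(lra) ltac:(lra); lra.
- by move=> /cpt_radius H; have := H ltac:(lra) ltac:(lra); lra.
Qed.

Lemma pigeonhole (T : finType) (f : nat -> T) :
  exists m n : nat, m != n /\ f m = f n.
Proof.
pose F (i : 'I_#|T|.+1) := f i.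
have /injectivePn[i [j ij Fij]] : ~~ injectiveb F.
  apply/negP => /injectiveP /leq_card; by rewrite card_ord ltnn.
by exists (val i), (val j).
Qed.

(** A basic neighbourhood of [q] inside [A] is a finite intersection of complements of convex sets;
    these sets cover the complement of [A] and miss [q]. *)
Lemma Tco_convex_cover (T : metricType R) (A : set T) (q : T) :
  Tco T A -> A q -> exists (I : finType) (C : I -> set T),
  [/\ forall a, geodesically_convex (C a), forall a, ~ C a q &
      ~` A `<=` \bigcup_a C a].
Proof.
move=> [D Dsub <-] [B DB By]; have [F Fsub FB] := Dsub _ DB.
pose F' : {fset set T} := F.
exists F', (fun U : F' => ~` fsval U).
split=> [U|U|x xA].
- by have /set_mem[] := Fsub _ (fsvalP U).
- by apply; move: By; rewrite -FB; apply; exact: fsvalP.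
- apply: contrapT => xC; apply: xA; exists B => //; rewrite -FB.
  change ((\bigcap_(U in [set` F']) U) x) => U /= FU.
  by apply: contrapT => xU; apply: xC; exists [` FU]%fset.
Qed.

Lemma special_not_coconvex : ~ Tco (X R) (~` (xval @^-1` special)).
Proof.
move=> Tsp; have /andP[hl hu] := @cos_pi4_bounds R.
have pt4 i k r : 0 <= r <= 2 -> exists x, xval x = cpt r (edge_pt i k (pi / 4)).
  by move=> r2; apply: xval_ex; exact: in_tri_pi4.
have pt0 i r : 0 <= r <= 2 -> exists x, xval x = cpt r (edge_pt i 0 0).
  by move=> r2; apply: xval_ex; exact: in_tri_branch.
have [|y ye] := pt4 0 0 (1 / 2); first by lra.
have [|p pe] := pt4 0 0 1; first by lra.
have [|o oe] := pt0 0 0; first by lra.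
have [I [C [CC Cy Ccover]]] := Tco_convex_cover Tsp (half_not_special ye).
(* The shift to [ik.2.+1] leaves out edge 0, which ends at [p]. *)
have /choice[e eP] : forall ik : nat * nat, exists x,
    xval x = cpt 2 (edge_pt ik.1 ik.2.+1 (pi / 4)).
  by move=> [i k]; apply: pt4; lra.
(* [f] selects a member of the cover containing the endpoint; [g] then picks in each copy two
   endpoints with the same selected member. *)
have /choice[f fP] : forall ik, exists a : I, C a (e ik).
  move=> [i k]; have [|a _ aC] := Ccover (e (i, k)); last by exists a.
  by rewrite setCK /=; right; exists i, k.+1; rewrite eP.
have /choice[g gP] : forall i, exists kk : nat * nat,
    kk.1 != kk.2 /\ f (i, kk.1) = f (i, kk.2).
  move=> i; have [m [n mn]] := pigeonhole (fun k => f (i, k)).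
  by exists (m, n).
(* Second pigeonhole: two copies whose chosen pairs lie in the same member. *)
have [i [j [ij fij]]] := pigeonhole (fun i => f (i, (g i).1)).
have CCi := CC (f (i, (g i).1)).
have br l x : xval x = cpt (2 * h) (edge_pt l 0 0) -> C (f (l, (g l).1)) x.
  have [gl fl] := gP l.
  apply: (convex_branch (CC _) _ (eP (l, (g l).1)) (fP _) (eP (l, (g l).2))).
    by rewrite eqSS.
  by rewrite fl; exact: fP.
apply: (Cy (f (i, (g i).1))).
have Cp : C (f (i, (g i).1)) p.
  have [|x1 x1e] := pt0 i (2 * h); first by lra.
  have [|x2 x2e] := pt0 j (2 * h); first by lra.
  apply: (convex_hub CCi ij x1e (br _ _ x1e) x2e _ pe).
  by rewrite fij; exact: br.
apply: (convex_ray CCi oe _ pe Cp ye).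
apply: (convex_tip CCi ij _ _ (eP (i, (g i).1)) (fP _) (eP (j, (g j).1)) _ oe).
- by [].
- by [].
- by rewrite fij; exact: fP.
Qed.

End convex_closure.

Theorem lemma4p1 (R : realType) :
  TDelta (X R) <> Tco (X R).
Proof.
move=> eq; apply: (@special_not_coconvex R); rewrite -eq.
rewrite /TDelta openC; apply/closed_weak_topology; exact: special_weakly_closed.
Qed.
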